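(* Let $n,m,r,s$ be nonnegative integers such that $m=3r+s$ and $1\le s\le 3$, and let $$\delta(n,r,s)=\begin{cases} n^2-(n-r)^2 & \text{if } s=1,\\ n^2-(n-r+1)(n-r-1) & \text{if } s=2,\\ n^2-(n-r)(n-r-1) & \text{if } s=3.\end{cases}$$ Suppose $n\ge 120m$. If $F_1,\ldots,F_m$ are $3$-partite $3$-graphs on the same vertex set with the same partition classes $V_1,V_2,V_3$, where $|V_1|=|V_2|=|V_3|=n$, and $\delta_1(F_i)>\delta(n,r,s)$ for every $i\in\{1,\ldots,m\}$, then $\{F_1,\ldots,F_m\}$ admits a rainbow matching of size $m$, i.e. there are pairwise disjoint edges $e_1\in E(F_1),\ldots,e_m\in E(F_m)$.
   Context: A $3$-partite $3$-graph with classes $V_1,V_2,V_3$ (pairwise disjoint sets) is a hypergraph on $V_1\cup V_2\cup V_3$ each of whose edges contains exactly one vertex from each $V_i$. For such a hypergraph $F$, $\delta_1(F)$ is the minimum, over all vertices $v$, of the number of edges of $F$ containing $v$. The $F_i$ need not be distinct. *)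

(* Defs.v *)
From mathcomp Require Import all_boot all_order all_algebra.

Set Implicit Arguments.
Unset Strict Implicit.
Unset Printing Implicit Defensive.

Import GRing.Theory Num.Theory.

(* A hypergraph is its set of edges, a {set {set T}}; the vertex set is the
   union of the classes V 0, V 1, V 2, which need not be all of T. *)

Definition vertices (T : finType) (V : 'I_3 -> {set T}) : {set T} :=
  \bigcup_(i < 3) V i.

Definition tripartite_3graph (T : finType) (V : 'I_3 -> {set T})
    (F : {set {set T}}) : Prop :=
  forall e : {set T}, e \in F ->
    e \subset vertices V /\ forall i : 'I_3, #|e :&: V i| = 1.

Definition degree (T : finType) (F : {set {set T}}) (v : T) : nat :=
  #|[set e in F | v \in e]|.

(* No degree exceeds #|F|, so the default value #|F| of the iterated minimum
   only matters when there are no vertices. *)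
Definition min_degree (T : finType) (V : 'I_3 -> {set T})
    (F : {set {set T}}) : nat :=
  \big[minn/#|F|]_(v in vertices V) degree F v.

Definition rainbow_matching (T : finType) (m : nat)
    (F : 'I_m -> {set {set T}}) (e : 'I_m -> {set T}) : Prop :=
  (forall i, e i \in F i) /\ (forall i j, i != j -> [disjoint e i & e j]).

(* Integer-valued, to avoid truncated subtraction; only s = 1, 2, 3 matter. *)
Definition delta (n r s : nat) : int :=
  (let N := n%:Z in let R := r%:Z in
   match s with
   | 1%N => N ^+ 2 - (N - R) ^+ 2
   | 2%N => N ^+ 2 - (N - R + 1) * (N - R - 1)
   | _ => N ^+ 2 - (N - R) * (N - R - 1)
   end)%R.

(* Main.v *)
Require Import Defs.
From mathcomp Require Import all_boot all_order all_algebra.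
From mathcomp Require Import zify.

Set Implicit Arguments.
Unset Strict Implicit.
Unset Printing Implicit Defensive.
Import Order.TTheory GRing.Theory Num.Theory.

(** Call a vertex v heavy for F_i when its degree in F_i exceeds 4mn.  A family
with a heavy vertex v is easy to serve last: two distinct vertices lie in at
most n common edges ([codegree_le]), so some edge of F_i through v avoids any
prescribed set of at most 4m other vertices.

Take a maximal set of pairs (i, v), with v heavy for F_i, that uses each family
and each vertex at most once ([maximal_partial_matching]).  Let K be its
families, U its vertices, and R the set of the q = m - #|U| remaining families.
Whatever rainbow matching R has outside U, it extends greedily along the heavy
pairs to all m families ([extend_heavy]), so only R matters.  By maximality,
every vertex outside U has degree at most 4mn <= n^2 / 30 in each family of R.

Put u_a = #|U :&: V_a|.  A vertex of V_a outside U lies in at most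
n^2 - (n - u_b)(n - u_c) edges meeting U ([degree_avoiding]), so after the
removal of U its degree is greater than
  delta(n, r, s) - n^2 + (n - u_b)(n - u_c).
Apply this to the class where U takes the most, hence to the two classes which
keep the most vertices.  Since u_1 + u_2 + u_3 = 3r + s - q, elementary
estimates show that this bound is at least about (q - 1) n / 4, with a single
exception.  Then each family of R keeps more than 3(q - 1) * 4mn edges, while
each of the at most 3(q - 1) vertices of previously chosen edges destroys at
most 4mn of them: the greedy choice works.  This comparison of
(q - 1) n^2 / 4 with 12 (q - 1) m n is where n >= 120m enters.

The exception is q = s = 2 with u_1 = u_2 = u_3 = r, where it is only known that
two families on three classes of size n - r have all degrees at least 2.
If these families were cross-intersecting, then the links of the vertices of one
class would be sets of at least two cells of a grid, any cell of a link of the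
first family sharing a line with any cell of a link of the second one at another
vertex.  This confines all links of the first family to a line or to the corners
of a rectangle ([crossing_links]), hence leaves a vertex of another class
uncovered ([disjoint_edges]). *)

(** * Arithmetic of the residual degrees *)

Local Open Scope ring_scope.

(** With N = n - r and y_i = r - u_i, the product (n - u_2)(n - u_3) exceeds N^2
by N (y_2 + y_3) + y_2 y_3, and k is delta(n, r, s) - n^2 + N^2.  The sum of the y_i being fixed, the two largest ones add up to at
least two thirds of it.  A negative y_2 y_3 does no harm: it forces
y_1 <= y_2 < 0, so the linear term gains N |y_1|, whereas |y_2 y_3| is at most
|y_1| N / 300 because y_3 <= r is small compared with N. *)
Lemma surplus_bound (N r q s k y1 y2 y3 : int) :
  0 <= r -> 1 <= q -> 360 * r <= N + r -> 0 < N ->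
  y1 + y2 + y3 = q - s -> y1 <= y2 -> y2 <= y3 -> y3 <= r ->
  [\/ s = 1 /\ k = 0, s = 2 /\ k = 1 | s = 3 /\ k = N] ->
  (q - 1) * N <= 4 * (N * (y2 + y3) + y2 * y3 + k) \/
  [/\ q = 2, s = 2, y1 = 0, y2 = 0 & y3 = 0].
Proof.
move=> r0 q1 Nr N0 ysum y12 y23 y3r hk.
have [y20|y20] := lerP 0 y2.
  have yy : 0 <= y2 * y3 by nia.
  have bnd c : q - 1 <= 4 * (y2 + y3 + c) ->
      (q - 1) * N <= 4 * (N * (y2 + y3) + N * c).
    move=> h.
    have : (q - 1) * N <= 4 * (y2 + y3 + c) * N by rewrite ler_wpM2r //; lia.
    lia.
  have := bnd 0; have := bnd 1.
  case: hk => [[sE kE]|[sE kE]|[sE kE]]; subst s k => b1 b0.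
  - left; have := b0 ltac:(lia); lia.
  - have [pE|p1] : (y2 + y3 = 0 \/ 1 <= y2 + y3) by lia.
      have [|->] : 2 <= q \/ q = 1 by lia.
        by right; split; lia.
      left; lia.
    left; have := b0 ltac:(lia); lia.
  - left; have := b1 ltac:(lia); lia.
left.
have prod : y1 * N <= 300 * (y2 * y3).
  have [y30|y30] := lerP 0 y3; last by nia.
  have h1 : 300 * y3 <= N by lia.
  have : (- y1) * (300 * y3) <= (- y1) * N by rewrite ler_wpM2l //; lia.
  have : y1 * y3 <= y2 * y3 by rewrite ler_wpM2r.
  lia.
have y1N : N <= (- y1) * N by nia.
have qN : N <= q * N by nia.
have pE : y2 + y3 = q - s - y1 by lia.
rewrite pE.
(* With y_2 negative, y_1 = -1 forces y_2 = -1, and the product is then known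
   exactly; from y_1 = -2 on, the estimate prod leaves room to spare. *)
have [a1|a2] : (y1 = -1 \/ 2 * N <= - y1 * N) by nia.
  have y2E : y2 = -1 by lia.
  have q12 : q = 1 \/ 2 * N <= q * N by nia.
  subst y1 y2.
  case: hk => [[sE kE]|[sE kE]|[sE kE]]; subst s k; case: q12 => [qE|q2];
    try subst q; lia.
case: hk => [[sE kE]|[sE kE]|[sE kE]]; subst s k; lia.
Qed.
Local Close Scope ring_scope.

(** The left-hand side of the inequality bounds the number of edges through
3(q - 1) light vertices; the right-hand side counts edges by their vertex in the
class that lost u1 vertices, when the degrees there are at least d. *)
Lemma residual_count (n r s q u1 u2 u3 d : nat) :
  1 <= s <= 3 -> 120 * (3 * r + s) <= n -> 0 < q ->
  u1 + u2 + u3 + q = 3 * r + s -> u3 <= u2 <= u1 ->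
  (delta n r s < d%:Z + (n%:Z ^+ 2 - (n - u2)%N%:Z * (n - u3)%N%:Z))%R ->
  3 * q.-1 * (4 * (3 * r + s) * n) < (n - u1) * d \/
  [/\ q = 2, s = 2, u1 = r, u2 = r & u3 = r].
Proof.
move=> s13 nm q0 usum /andP[u32 u21] hd.
pose N := (n%:Z - r%:Z)%R.
pose k := (match s with 1%N => 0 | 2%N => 1 | _ => N end)%R.
pose y (u : nat) := (r%:Z - u%:Z)%R.
have n2 : ((n - u2)%N%:Z = N + y u2)%R by rewrite /N /y; lia.
have n3 : ((n - u3)%N%:Z = N + y u3)%R by rewrite /N /y; lia.
have hk : [\/ s%:Z = 1 /\ k = 0, s%:Z = 2 /\ k = 1 | s%:Z = 3 /\ k = N]%R.
  rewrite /k; case: s s13 {nm usum hd k} => [|[|[|[|s]]]] //= _;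
  by [apply: Or31|apply: Or32|apply: Or33].
have hd' : (N * (y u2 + y u3) + y u2 * y u3 + k < d%:Z)%R.
  move: hd; rewrite n2 n3 -/N.
  have -> : (delta n r s = n%:Z ^+ 2 - N ^+ 2 + k)%R.
    rewrite /delta /k /N; case: s s13 {nm usum hk k} => [|[|[|[|s]]]] //= _; lia.
  rewrite !expr2; lia.
have [|||||||||surp|[qE sE y1 y2 y3]] := @surplus_bound N r q s k (y u1) (y u2) (y u3).
all: try by rewrite /N /y; lia.
- by [].
- left.
  have NE : (n%:Z = N + r%:Z)%R by rewrite /N; lia.
  have qE : (q.-1%:Z = q%:Z - 1)%R by lia.
  have d4 : (q.-1%:Z * N + 4 <= 4 * d%:Z)%R by rewrite qE; lia.
  have step : ((n - u1)%N%:Z * (q.-1%:Z * N + 4) <= (n - u1)%N%:Z * (4 * d%:Z))%R.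
    by rewrite ler_wpM2l.
  (* Here n - u1 >= 119n/120 and N >= 359n/360, whereas 48m <= 2n/5. *)
  have big : (48 * ((3 * r + s)%N%:Z * n%:Z) <= (n - u1)%N%:Z * N)%R.
    have a1 : (120 * (3 * r + s)%N%:Z * n%:Z <= n%:Z * n%:Z)%R.
      by rewrite ler_wpM2r //; lia.
    have a2 : ((119 * n%:Z) * (359 * n%:Z) <= (120 * (n - u1)%N%:Z) * (360 * N))%R.
      by apply: ler_pM; lia.
    move: a1 a2; move: (n - u1) (3 * r + s) => w m; clear.
    lia.
  have := @ler_wpM2l _ q.-1%:Z%R isT _ _ big.
  have : (0 < (n - u1)%N%:Z)%R by lia.
  move: step; move: (n - u1) (3 * r + s) (q.-1) => w m p; clear.
  lia.
right; rewrite /y in y1 y2 y3; split; lia.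
Qed.

(** * Three classes *)

Lemma ord3_third (a b : 'I_3) : a != b ->
  exists c, [/\ a != c, b != c & forall i, [|| i == a, i == b | i == c]].
Proof.
move=> ab.
have/eqP/cards1P[c cE] : #|~: [set a; b]| = 1.
  by rewrite cardsCs setCK cards2 ab card_ord.
have inc i : (i == c) = (i \notin [set a; b]) by rewrite -in_set1 -cE inE.
have : c \notin [set a; b] by rewrite -inc.
rewrite !inE negb_or eq_sym [c == b]eq_sym => /andP[ac bc].
by exists c; split=> // i; rewrite inc !inE orbA orbN.
Qed.

Lemma ord3_cover (a b c : 'I_3) : a != b -> a != c -> b != c ->
  forall i, [|| i == a, i == b | i == c].
Proof.
move=> ab ac bc; have [d [_ _ cov]] := ord3_third ab.
by have := cov c; rewrite eq_sym (negPf ac) eq_sym (negPf bc) /= => /eqP->.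
Qed.

Lemma ord3_sorted (u : 'I_3 -> nat) : exists a b c : 'I_3,
  [/\ a != b, a != c, b != c, u c <= u b <= u a &
      u a + u b + u c = \sum_i u i].
Proof.
pose i0 := ord0 : 'I_3; pose i1 := lift ord0 ord0 : 'I_3; pose i2 := ord_max : 'I_3.
have -> : \sum_i u i = u i0 + u i1 + u i2.
  rewrite !big_ord_recl big_ord0 addn0 addnA; congr (_ + u _); exact: val_inj.
have [h01|h01] := leqP (u i0) (u i1); have [h12|h12] := leqP (u i1) (u i2);
  have [h02|h02] := leqP (u i0) (u i2).
all: first [by exists i0, i1, i2; split=> //; lia | by exists i0, i2, i1; split=> //; lia
 | by exists i1, i0, i2; split=> //; lia | by exists i1, i2, i0; split=> //; lia
 | by exists i2, i0, i1; split=> //; lia | by exists i2, i1, i0; split=> //; lia].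
Qed.

(** * Edges avoiding a set of vertices *)

Lemma card_bigcup_le (T I : finType) (L : {set I}) (f : I -> {set T}) (k : nat) :
  (forall i, i \in L -> #|f i| <= k) -> #|\bigcup_(i in L) f i| <= k * #|L|.
Proof.
move=> fk; rewrite mulnC -sum_nat_const.
elim/big_ind2: _ => [|A j B l Aj Bl|i /fk //]; first by rewrite cards0.
by rewrite (leq_trans (leq_card_setU _ _)) // leq_add.
Qed.

Definition avoiding (T : finType) (F : {set {set T}}) (U : {set T}) :=
  [set e in F | [disjoint e & U]].

Lemma meet_disjointPn (T : finType) (A B : {set T}) :
  reflect (exists2 x, x \in A & x \in B) (~~ [disjoint A & B]).
Proof.
apply: (iffP pred0Pn) => [[x /andP[]]|[x xA xB]]; first by exists x.
by exists x; rewrite /= xA.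
Qed.

Lemma exists_avoiding (T : finType) (F : {set {set T}}) (S : {set T}) (D : nat) :
  (forall x, x \in S -> degree F x <= D) -> #|S| * D < #|F| ->
  exists2 e, e \in F & [disjoint e & S].
Proof.
move=> degD big.
suff /existsP[e /andP[]] : [exists e, (e \in F) && [disjoint e & S]] by exists e.
apply: contraLR big => /existsPn none; rewrite -leqNgt.
have sub : F \subset \bigcup_(x in S) [set e in F | x \in e].
  apply/subsetP => e eF; have := none e; rewrite eF /=.
  by case/meet_disjointPn=> x xe xS; apply/bigcupP; exists x; rewrite // inE eF.
by rewrite mulnC (leq_trans (subset_leq_card sub)) // card_bigcup_le.
Qed.

(** * Tripartite 3-graphs *)

Lemma trace_vertex (T : finType) (V : 'I_3 -> {set T}) (F : {set {set T}})
    (e : {set T}) (i : 'I_3) (x : T) : tripartite_3graph V F ->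
  e \in F -> x \in e -> x \in V i -> e :&: V i = [set x].
Proof.
move=> triF eF xe xV; have [_ /(_ i)/eqP/cards1P[y yE]] := triF e eF.
have : x \in e :&: V i by rewrite inE xe.
by rewrite yE => /set1P->.
Qed.

Lemma edge_trace (T : finType) (V : 'I_3 -> {set T}) (F : {set {set T}})
    (e : {set T}) (i : 'I_3) : tripartite_3graph V F -> e \in F ->
  exists x, [/\ x \in e, x \in V i & e :&: V i = [set x]].
Proof.
move=> triF eF; have [_ /(_ i)/eqP/cards1P[y yE]] := triF e eF.
have : y \in e :&: V i by rewrite yE set11.
by rewrite inE => /andP[ye yV]; exists y.
Qed.

Lemma edge_vertex (T : finType) (V : 'I_3 -> {set T}) (F : {set {set T}})
    (e : {set T}) (x : T) : tripartite_3graph V F -> e \in F -> x \in e ->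
  exists i, x \in V i.
Proof.
move=> triF eF xe; have [/subsetP/(_ x xe)/bigcupP[i _ xi] _] := triF e eF.
by exists i.
Qed.

(** An edge is the union of its three traces, so it may be handled as a triple
of singletons without choosing coordinates. *)
Lemma edge_eq (T : finType) (V : 'I_3 -> {set T}) (F : {set {set T}})
    (e e' : {set T}) : tripartite_3graph V F -> e \in F -> e' \in F ->
  (forall i, e :&: V i = e' :&: V i) -> e = e'.
Proof.
move=> triF eF e'F eq_tr.
have [/setIidPl <- _] := triF e eF; have [/setIidPl <- _] := triF e' e'F.
by rewrite /vertices !big_distrr /=; apply: eq_bigr => i _.
Qed.

Lemma edge_size (T : finType) (V : 'I_3 -> {set T}) (F : {set {set T}})
    (e : {set T}) : tripartite_3graph V F -> e \in F -> #|e| <= 3.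
Proof.
move=> triF eF; have [/setIidPl eE one] := triF e eF.
rewrite -eE /vertices big_distrr /= (eq_bigl (fun i => i \in setT)); last first.
  by move=> i; rewrite inE.
rewrite (leq_trans (card_bigcup_le (k := 1) _)) ?cardsT ?card_ord // => i _.
by rewrite one.
Qed.

Lemma tripartite_sub (T : finType) (V : 'I_3 -> {set T}) (F G : {set {set T}}) :
  G \subset F -> tripartite_3graph V F -> tripartite_3graph V G.
Proof. by move=> /subsetP GF triF e /GF; apply: triF. Qed.

Lemma avoiding_sub (T : finType) (F : {set {set T}}) (U : {set T}) :
  avoiding F U \subset F.
Proof. by apply/subsetP => e; rewrite inE => /andP[]. Qed.

Lemma degree_sub (T : finType) (F G : {set {set T}}) (v : T) :
  G \subset F -> degree G v <= degree F v.
Proof.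
move=> /subsetP GF; apply/subset_leq_card/subsetP => e.
by rewrite !inE => /andP[/GF-> ->].
Qed.

Lemma class_uniq (T : finType) (V : 'I_3 -> {set T}) (i j : 'I_3) (x : T) :
  (forall i j : 'I_3, i != j -> [disjoint V i & V j]) ->
  x \in V i -> x \in V j -> i = j.
Proof.
move=> hdisj xi xj; apply/eqP/contraT => /hdisj/pred0P/(_ x).
by rewrite /= xi xj.
Qed.

(** An edge through u and v is determined by its vertex in the third class; if u
and v share a class there is no such edge. *)
Lemma codegree_le (T : finType) (V : 'I_3 -> {set T}) (F : {set {set T}})
    (n : nat) (u v : T) :
  (forall i, #|V i| = n) -> tripartite_3graph V F -> u != v ->
  degree [set e in F | v \in e] u <= n.
Proof.
move=> hV triF uv; rewrite /degree.
set A := [set e in _ | _].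
have AF e : e \in A -> [/\ e \in F, u \in e & v \in e].
  by rewrite !inE => /andP[/andP[-> ->] ->].
have [->|[e0 /AF[e0F ue0 ve0]]] := set_0Vmem A; first by rewrite cards0.
have [a ua] := edge_vertex triF e0F ue0.
have [b vb] := edge_vertex triF e0F ve0.
have ab : a != b.
  apply: contraNneq uv => abE; rewrite -abE in vb.
  by rewrite -in_set1 -(trace_vertex triF e0F ve0 vb) inE ue0.
have [c [_ _ cov]] := ord3_third ab.
rewrite -(hV c) -(card_imset _ (@set1_inj T)).
rewrite -(@card_in_imset _ _ (fun e => e :&: V c) A); last first.
  move=> e e' /AF[eF ue ve] /AF[e'F ue' ve'] /= cE.
  apply: (edge_eq triF eF e'F) => i; case/or3P: (cov i) => /eqP-> //.
    by rewrite (trace_vertex triF eF ue ua) (trace_vertex triF e'F ue' ua).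
  by rewrite (trace_vertex triF eF ve vb) (trace_vertex triF e'F ve' vb).
apply/subset_leq_card/subsetP => _ /imsetP[e /AF[eF _ _] ->].
have [x [_ xV ->]] := edge_trace c triF eF.
exact: imset_f.
Qed.

(** An edge through v is determined by a pair of vertices of the other two
classes, and it meets U only if one of these two lies in U. *)
Lemma degree_avoiding (T : finType) (V : 'I_3 -> {set T}) (F : {set {set T}})
    (U : {set T}) (n : nat) (a b c : 'I_3) (v : T) :
  (forall i, #|V i| = n) -> tripartite_3graph V F ->
  a != b -> a != c -> b != c -> v \in V a -> v \notin U ->
  degree F v + #|V b :\: U| * #|V c :\: U| <= degree (avoiding F U) v + n * n.
Proof.
move=> hV triF ab ac bc va vU.
have cov := ord3_cover ab ac bc.
pose A := [set e in F | v \in e].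
pose B := A :\: [set e in avoiding F U | v \in e].
have degE : degree F v <= degree (avoiding F U) v + #|B|.
  rewrite /degree -/A -(cardsID [set e in avoiding F U | v \in e] A).
  by rewrite leq_add2r subset_leq_card // subsetIr.
suff : #|B| + #|V b :\: U| * #|V c :\: U| <= n * n by lia.
have BP e : e \in B -> [/\ e \in F, v \in e & ~~ [disjoint e & U]].
  by rewrite !inE; case: (e \in F); case: (v \in e); case: [disjoint e & U].
pose s1 (W : {set T}) := set1 @: W : {set {set T}}.
have s1c W : #|s1 W| = #|W| by rewrite card_imset //; exact: set1_inj.
pose P := setX (s1 (V b)) (s1 (V c)).
pose Q := setX (s1 (V b :\: U)) (s1 (V c :\: U)).
have QP : Q \subset P.
  by rewrite setXS // imsetS // subsetDl.
have Pc : #|P| = n * n by rewrite cardsX !s1c !hV.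
have Qc : #|Q| = #|V b :\: U| * #|V c :\: U| by rewrite cardsX !s1c.
rewrite -Pc -Qc -(cardsID Q P) (setIidPr QP) addnC leq_add2l.
rewrite -(@card_in_imset _ _ (fun e => (e :&: V b, e :&: V c)) B); last first.
  move=> e e' /BP[eF ve _] /BP[e'F ve' _] /= [bE cE].
  apply: (edge_eq triF eF e'F) => i; case/or3P: (cov i) => /eqP-> //.
  by rewrite (trace_vertex triF eF ve va) (trace_vertex triF e'F ve' va).
apply/subset_leq_card/subsetP => _ /imsetP[e /BP[eF ve eU] ->].
have [x [xe xV xE]] := edge_trace b triF eF.
have [y [ye yV yE]] := edge_trace c triF eF.
have mem1 (z : T) W : ([set z] \in s1 W) = (z \in W).
  by rewrite mem_imset //; exact: set1_inj.
rewrite !inE /= xE yE !mem1 xV yV andbT !inE xV yV !andbT.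
apply: contra eU; case/andP=> xU yU.
apply/pred0P => z /=; apply/negP => /andP[ze zU].
have [i zi] := edge_vertex triF eF ze.
have {}zi : z \in e :&: V i by rewrite inE ze.
case/or3P: (cov i) => /eqP iE; move: zi; rewrite iE.
- by rewrite (trace_vertex triF eF ve va) => /set1P zE; rewrite -zE zU in vU.
- by rewrite xE => /set1P zE; rewrite -zE zU in xU.
- by rewrite yE => /set1P zE; rewrite -zE zU in yU.
Qed.

Lemma card_edges_ge (T : finType) (V : 'I_3 -> {set T}) (F : {set {set T}})
    (A : {set T}) (a : 'I_3) (d : nat) :
  tripartite_3graph V F -> A \subset V a ->
  (forall v, v \in A -> d <= degree F v) -> #|A| * d <= #|F|.
Proof.
move=> triF AV dle; rewrite -sum_nat_const.
apply: (leq_trans (n := \sum_(v in A) degree F v)); first exact: leq_sum.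
rewrite (eq_bigr (fun v => \sum_(e in F) (v \in e))); last first.
  by move=> v _; rewrite /degree -sum1dep_card big_mkcondr.
rewrite exchange_big -sum1_card; apply: leq_sum => e eF.
rewrite -[leqRHS]((triF e eF).2 a) -sum1_card [leqRHS]big_mkcond [leqLHS]big_mkcond /=.
apply: leq_sum => v _; rewrite inE.
by case: ifP => // vA; rewrite (subsetP AV _ vA) andbT; case: (v \in e).
Qed.

(** * Greedy choice and heavy vertices *)

(** The sets [h i] are protected: no other family may use them, so that the
family i can be required to pass through a vertex of [h i], and the extension
hypothesis needs to hold only for sets S that leave [h i] free. *)
Lemma greedy_rainbow (T I : finType) (K : {set I}) (g : I -> {set {set T}})
    (h : I -> {set T}) :
  (forall i (e : {set T}), i \in K -> e \in g i -> #|e| <= 3) ->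
  (forall i j (e : {set T}), i \in K -> j \in K -> i != j -> e \in g i ->
     [disjoint e & h j]) ->
  (forall i (S : {set T}), i \in K -> #|S| <= 3 * #|K|.-1 -> [disjoint S & h i] ->
     exists2 e, e \in g i & [disjoint e & S]) ->
  exists f : I -> {set T}, (forall i, i \in K -> f i \in g i) /\
    forall i j, i \in K -> j \in K -> i != j -> [disjoint f i & f j].
Proof.
move=> size3 away ext.
suff: forall k (L : {set I}), #|L| = k -> L \subset K ->
    exists f : I -> {set T}, (forall i, i \in L -> f i \in g i) /\
      forall i j, i \in L -> j \in L -> i != j -> [disjoint f i & f j].
  by move/(_ _ K erefl (subxx K)).
elim=> [|k IHk] L Lk LK.
  have L0 := cards0_eq Lk.
  by exists (fun=> set0); split=> i; rewrite L0 inE.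
have/card_gt0P[i iL] : 0 < #|L| by rewrite Lk.
have L'k : #|L :\ i| = k by have := cardsD1 i L; rewrite iL Lk => -[].
have L'K : L :\ i \subset K := subset_trans (subsetDl _ _) LK.
have [f [fg fd]] := IHk _ L'k L'K.
have iK := subsetP LK i iL.
pose S := \bigcup_(j in L :\ i) f j.
have Sk : #|S| <= 3 * #|K|.-1.
  have : #|S| <= 3 * #|L :\ i|.
    by apply: card_bigcup_le => j jL; apply: size3 (fg j jL); apply: (subsetP L'K).
  have := subset_leq_card LK; rewrite L'k Lk; lia.
have Sh : [disjoint S & h i].
  rewrite disjoint_sym; apply: bigcup_disjoint => j jL; rewrite disjoint_sym.
  apply: away (fg j jL) => //.
    exact: (subsetP L'K).
  by move: jL; rewrite !inE => /andP[].
have [e eg eS] := ext i S iK Sk Sh.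
have dis j : j \in L -> j != i -> [disjoint e & f j].
  move=> jL ji; apply: disjointWr eS; apply: (bigcup_sup j).
  by rewrite !inE ji.
exists (fun j => if j == i then e else f j); split=> [j jL|j j' jL j'L].
  by case: eqP => [->|/eqP ji] //; apply: fg; rewrite !inE ji.
move=> jj'; have [jE|ji] := eqVneq j i; have [j'E|j'i] := eqVneq j' i.
- by rewrite jE j'E eqxx in jj'.
- exact: dis.
- by rewrite disjoint_sym; apply: dis.
- by apply: fd; rewrite // !inE ?ji ?j'i.
Qed.

Lemma maximal_partial_matching (I T : finType) (x0 : T) (R : I -> T -> bool) :
  exists (K : {set I}) (phi : I -> T),
    [/\ {in K &, injective phi}, forall i, i \in K -> R i (phi i) &
        forall i v, i \notin K -> v \notin phi @: K -> ~~ R i v].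
Proof.
pose good (p : {set I} * {ffun I -> T}) :=
  [forall i in p.1, R i (p.2 i)] &&
  [forall i in p.1, forall j in p.1, (p.2 i == p.2 j) ==> (i == j)].
have good0 : good (set0, [ffun=> x0]).
  by apply/andP; split; apply/forall_inP => i; rewrite inE.
case: (arg_maxnP (fun p : {set I} * {ffun I -> T} => #|p.1|) good0)
  => -[K phi] /= /andP[/forall_inP heavy inj] maxK.
have {}inj : {in K &, injective phi}.
  move=> i j iK jK /eqP eq_phi.
  by move/forall_inP/(_ _ iK)/forall_inP/(_ _ jK)/implyP/(_ eq_phi)/eqP: inj.
exists K, phi; split=> // i v iK vphi; apply/negP => Riv.
have neq j : j \in K -> j == i = false by move=> jK; apply: contraNF iK => /eqP<-.
pose psi := [ffun j => if j == i then v else phi j].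
have psiK j : j \in K -> psi j = phi j by move=> jK; rewrite ffunE neq.
have psii : psi i = v by rewrite ffunE eqxx.
have vneq j : j \in K -> phi j == v = false.
  by move=> jK; apply: contraNF vphi => /eqP<-; apply: imset_f.
suff /maxK : good (i |: K, psi) by rewrite /= cardsU1 iK ltnn.
apply/andP; split; apply/forall_inP => j /= /setU1P[->|jK].
- by rewrite psii.
- by rewrite psiK // heavy.
- apply/forall_inP => j' /setU1P[->|j'K]; first by rewrite !eqxx.
  by rewrite psii psiK // eq_sym vneq.
- apply/forall_inP => j' /setU1P[->|j'K].
    by rewrite psii psiK // vneq.
  by rewrite !psiK //; apply/implyP => /eqP/inj->.
Qed.

(** Here M0 is the union of edges already chosen for the families outside K.
When family k is served, M0, the other heavy vertices and the edges chosen for K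
so far amount to at most 4 #|I| vertices, each blocking at most n of the edges
through [phi k]. *)
Lemma extend_heavy (T I : finType) (V : 'I_3 -> {set T})
    (F : I -> {set {set T}}) (n : nat) (K : {set I}) (phi : I -> T) (M0 : {set T}) :
  (forall i, #|V i| = n) -> (forall i, tripartite_3graph V (F i)) ->
  {in K &, injective phi} ->
  #|M0| <= 3 * (#|I| - #|K|) -> [disjoint M0 & phi @: K] ->
  (forall k, k \in K -> 4 * #|I| * n < degree (F k) (phi k)) ->
  exists f : I -> {set T},
    (forall k, k \in K -> f k \in avoiding (F k) M0) /\
    forall j k, j \in K -> k \in K -> j != k -> [disjoint f j & f k].
Proof.
move=> hV triF inj M0size M0U heavy; set U := phi @: K in M0U *.
pose blocked k := M0 :|: (U :\ phi k).
pose g k := [set e in avoiding (F k) (blocked k) | phi k \in e].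
have gP k e : e \in g k -> [/\ e \in F k, [disjoint e & blocked k] & phi k \in e].
  by rewrite !inE => /andP[/andP[-> ->] ->].
have [||i S iK Ssize Sphi|f [fg fd]] :=
    @greedy_rainbow T I K g (fun k => [set phi k]).
- by move=> i e _ /gP[eF _ _]; apply: edge_size eF.
- move=> i j e iK jK ij /gP[_ dis _]; rewrite disjoint_sym disjoints1.
  apply/negP => je; move/pred0P/(_ (phi j)): dis; rewrite /= je !inE.
  rewrite (imset_f phi jK) andbT orbC; case: eqP => // /(inj _ _ jK iK) ji.
  by rewrite ji eqxx in ij.
- have [||e] := @exists_avoiding T [set e in F i | phi i \in e] (S :|: blocked i) n.
  + move=> x xS; apply: codegree_le hV (triF i) _.
    apply: contraTneq xS => ->; rewrite !inE eqxx /= orbF negb_or.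
    move: Sphi; rewrite disjoint_sym disjoints1 => -> /=.
    by have := disjointFl M0U (imset_f phi iK) => ->.
  + apply: leq_ltn_trans (heavy i iK); rewrite leq_mul2r; apply/orP; right.
    have sU : #|U :\ phi i| = #|K|.-1.
      by have := cardsD1 (phi i) U; rewrite imset_f // card_in_imset // => ->.
    have : #|blocked i| <= #|M0| + #|K|.-1.
      by rewrite -sU leq_card_setU.
    have := (leq_card_setU S (blocked i)).1.
    have : #|K| <= #|I| by apply: max_card.
    have : 0 < #|K| by apply/card_gt0P; exists i.
    lia.
  rewrite inE => /andP[eF ie] dis; exists e.
    by rewrite !inE eF ie (disjointWr _ dis) // subsetUr.
  by rewrite (disjointWr _ dis) // subsetUl.
exists f; split=> // k kK; have /gP[fF dis _] := fg k kK.
by rewrite inE fF (disjointWr _ dis) // subsetUl.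
Qed.

(** * Two families with all degrees at least two *)

(** Read x and y as the two coordinates of a cell of a grid, P b and Q b as the
links at b.  Two cells p, p' of P b0 determine where the Q-links at other
vertices can be: if p and p' are on a line, any cell on a line with both lies on
that line; otherwise the only such cells are the other two corners of the
rectangle spanned by p and p'.  Two distinct cells of such a Q-link confine the
P-links in the same way.  A third vertex is required to pass from b0 to a link
at an arbitrary b, b0 included. *)
Lemma crossing_links (B E : finType) (X : eqType) (W : {set B})
    (P Q : B -> {set E}) (x y : E -> X) :
  2 < #|W| ->
  (forall b, b \in W -> exists e e',
     [/\ e \in P b, e' \in P b & x e != x e' \/ y e != y e']) ->
  (forall b, b \in W -> exists e e',
     [/\ e \in Q b, e' \in Q b & x e != x e' \/ y e != y e']) ->
  (forall b c e f, b \in W -> c \in W -> b != c -> e \in P b -> f \in Q c ->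
     x e = x f \/ y e = y f) ->
  exists a a', (forall b e, b \in W -> e \in P b -> x e = a \/ x e = a') \/
               (forall b e, b \in W -> e \in P b -> y e = a \/ y e = a').
Proof.
move=> W3 twoP twoQ cross.
have other b c : exists2 d, d \in W & (d != b) && (d != c).
  have : 0 < #|W :\: [set b; c]|.
    rewrite cardsD subn_gt0 (leq_ltn_trans (subset_leq_card (subsetIr _ _))) //.
    by rewrite cards2; case: (b != c) => //; apply: leq_trans W3.
  by case/card_gt0P=> d; rewrite !inE negb_or => /andP[? ?]; exists d.
have [b0 b0W] : exists b, b \in W by apply/card_gt0P; lia.
have [p [p' [pP p'P pp']]] := twoP b0 b0W.
have neqP (e e' : E) : x e != x e' \/ y e != y e' -> x e <> x e' \/ y e <> y e'.
  by case=> /eqP; [left|right].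
have {}pp' := neqP _ _ pp'.
have key b e : b \in W -> e \in P b -> exists q q',
    [/\ x q <> x q' \/ y q <> y q',
        (x p = x q \/ y p = y q) /\ (x p' = x q \/ y p' = y q),
        (x p = x q' \/ y p = y q') /\ (x p' = x q' \/ y p' = y q')
      & (x e = x q \/ y e = y q) /\ (x e = x q' \/ y e = y q')].
  move=> bW eP; have [c cW /andP[cb0 cb]] := other b0 b.
  have [q [q' [qQ q'Q qq']]] := twoQ c cW.
  rewrite eq_sym in cb0; rewrite eq_sym in cb.
  have crs d f f' : d \in W -> d != c -> f \in P d -> f' \in Q c ->
      x f = x f' \/ y f = y f' by move=> dW dc; apply: cross.
  exists q, q'; split; first exact: neqP.
  - by split; apply: (crs b0).
  - by split; apply: (crs b0).
  - by split; apply: (crs b).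
have [xE|/eqP xN] := eqVneq (x p) (x p').
  exists (x p), (x p); left=> b e bW /(key b e bW)[q [q' [qq [A1 A2] [A3 A4] [A5 A6]]]].
  clear key other cross twoP twoQ neqP; left.
  have yN : y p <> y p' by case: pp'.
  have qE : x q = x p by case: A1 => A1; case: A2 => A2; congruence.
  have q'E : x q' = x p by case: A3 => A3; case: A4 => A4; congruence.
  by case: qq => qq; case: A5 => A5; case: A6 => A6; congruence.
have [yE|/eqP yN] := eqVneq (y p) (y p').
  exists (y p), (y p); right=> b e bW /(key b e bW)[q [q' [qq [A1 A2] [A3 A4] [A5 A6]]]].
  clear key other cross twoP twoQ neqP; left.
  have qE : y q = y p by case: A1 => A1; case: A2 => A2; congruence.
  have q'E : y q' = y p by case: A3 => A3; case: A4 => A4; congruence.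
  by case: qq => qq; case: A5 => A5; case: A6 => A6; congruence.
exists (x p), (x p'); left=> b e bW /(key b e bW)[q [q' [qq [A1 A2] [A3 A4] [A5 A6]]]].
clear key other cross twoP twoQ neqP pp'.
have [qp|qp] : (x q = x p /\ y q = y p') \/ (x q = x p' /\ y q = y p).
- by case: A1 => A1; case: A2 => A2; [congruence|left|right|congruence].
- have [q'E q'E'] : x q' = x p' /\ y q' = y p.
    by case: qp => qE1 qE2; case: A3 => A3; case: A4 => A4; case: qq => qq; split; congruence.
  by case: A5 => A5; case: A6 => A6; case: qp => qE1 qE2; [left|left|right|right]; congruence.
have [q'E q'E'] : x q' = x p /\ y q' = y p'.
  by case: qp => qE1 qE2; case: A3 => A3; case: A4 => A4; case: qq => qq; split; congruence.
by case: A5 => A5; case: A6 => A6; case: qp => qE1 qE2; [right|right|left|left]; congruence.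
Qed.

Lemma two_edges (T : finType) (V : 'I_3 -> {set T}) (G : {set {set T}}) (v : T)
    (a b c : 'I_3) :
  tripartite_3graph V G -> a != b -> a != c -> b != c -> v \in V b ->
  1 < degree G v -> exists e e' : {set T},
  [/\ e \in [set e in G | v \in e], e' \in [set e in G | v \in e] &
      e :&: V a != e' :&: V a \/ e :&: V c != e' :&: V c].
Proof.
move=> triG ab ac bc vb /card_gt1P[e [e' [eG e'G ee']]].
exists e, e'; split=> //; apply/orP; rewrite -negb_and.
apply: contra ee' => /andP[/eqP aE /eqP cE]; apply/eqP.
move: eG e'G; rewrite !inE => /andP[eG ve] /andP[e'G ve'].
apply: (edge_eq triG eG e'G) => i.
case/or3P: (ord3_cover ab ac bc i) => /eqP-> //.
by rewrite (trace_vertex triG eG ve vb) (trace_vertex triG e'G ve' vb).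
Qed.

Lemma uncovered_class (T : finType) (V : 'I_3 -> {set T}) (G : {set {set T}})
    (W : {set T}) (i : 'I_3) (A A' : {set T}) :
  tripartite_3graph V G -> W \subset V i -> 2 < #|W| ->
  (forall v, v \in W -> 0 < degree G v) ->
  exists2 e, e \in G & e :&: V i <> A /\ e :&: V i <> A'.
Proof.
move=> triG WV W3 deg.
have : 0 < #|set1 @: W :\: [set A; A']|.
  rewrite cardsD subn_gt0 (leq_ltn_trans (subset_leq_card (subsetIr _ _))) //.
  rewrite card_imset; last exact: set1_inj.
  by rewrite cards2; case: (A != A') => //; apply: leq_trans W3.
case/card_gt0P=> B; rewrite !inE negb_or => /andP[/andP[/eqP BA /eqP BA']].
case/imsetP=> v vW BE; have /card_gt0P[e] := deg v vW.
rewrite inE => /andP[eG ve]; exists e => //.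
by rewrite (trace_vertex triG eG ve (subsetP WV _ vW)) -BE.
Qed.

(** If all edges of G met all edges of H, then at distinct vertices of the
middle class their links in the other two classes would cross, and by
[crossing_links] G would cover at most two vertices of some class. *)
Lemma disjoint_edges (T : finType) (V : 'I_3 -> {set T})
    (G H : {set {set T}}) (W : 'I_3 -> {set T}) :
  tripartite_3graph V G -> tripartite_3graph V H ->
  (forall i, W i \subset V i) -> (forall i, 2 < #|W i|) ->
  (forall i e, e \in G -> e :&: V i \subset W i) ->
  (forall i v, v \in W i -> 1 < degree G v) ->
  (forall i v, v \in W i -> 1 < degree H v) ->
  exists e e', [/\ e \in G, e' \in H & [disjoint e & e']].
Proof.
move=> triG triH WV W3 GW degG degH.
suff /exists_inP[e eG /exists_inP[e' e'H dis]] :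
  [exists e in G, exists e' in H, [disjoint e & e']] by exists e, e'.
apply: contraT => /exists_inPn none.
have meet e e' : e \in G -> e' \in H -> exists2 x, x \in e & x \in e'.
  by move=> eG e'H; have /exists_inPn/(_ e' e'H)/meet_disjointPn := none e eG.
pose a := ord0 : 'I_3; pose b := lift ord0 ord0 : 'I_3; pose c := ord_max : 'I_3.
have ab : a != b by []. have ac : a != c by []. have bc : b != c by [].
have cov := ord3_cover ab ac bc.
pose P := fun (F : {set {set T}}) v => [set e in F | v \in e].
have two F v : tripartite_3graph V F -> v \in W b -> 1 < degree F v ->
    exists e e' : {set T}, [/\ e \in P F v, e' \in P F v &
      e :&: V a != e' :&: V a \/ e :&: V c != e' :&: V c].
  by move=> triF vW; apply: two_edges triF ab ac bc (subsetP (WV b) v vW).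
have cross u v e f : u \in W b -> v \in W b -> u != v -> e \in P G u ->
    f \in P H v -> e :&: V a = f :&: V a \/ e :&: V c = f :&: V c.
  move=> uW vW uv; rewrite !inE => /andP[eG ue] /andP[fH vf].
  have [x xe xf] := meet e f eG fH.
  have [i xi] := edge_vertex triG eG xe.
  have tr : e :&: V i = f :&: V i.
    by rewrite (trace_vertex triG eG xe xi) (trace_vertex triH fH xf xi).
  case/or3P: (cov i) tr => /eqP->; [by left | | by right].
  rewrite (trace_vertex triG eG ue (subsetP (WV b) u uW)).
  rewrite (trace_vertex triH fH vf (subsetP (WV b) v vW)) => /set1_inj uvE.
  by rewrite uvE eqxx in uv.
have [A [A']] := crossing_links (W3 b) (fun v vW => two G v triG vW (degG b v vW))
  (fun v vW => two H v triH vW (degH b v vW)) cross.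
have deg0 i v : v \in W i -> 0 < degree G v by move=> /degG/ltnW.
have link e : e \in G -> exists2 v, v \in W b & e \in P G v.
  move=> eG; have [v [ve vb trb]] := edge_trace b triG eG.
  exists v; last by rewrite inE eG.
  by have := GW b e eG; rewrite trb sub1set.
case=> [cover|cover].
  have [e eG [nA nA']] := uncovered_class A A' triG (WV a) (W3 a) (deg0 a).
  by have [v vW eP] := link e eG; case: (cover v e vW eP).
have [e eG [nA nA']] := uncovered_class A A' triG (WV c) (W3 c) (deg0 c).
by have [v vW eP] := link e eG; case: (cover v e vW eP).
Qed.

(** * Rainbow matchings of the light families *)

Lemma min_degree_le (T : finType) (V : 'I_3 -> {set T}) (F : {set {set T}}) (v : T) :
  v \in vertices V -> min_degree V F <= degree F v.
Proof.
move=> vV; rewrite /min_degree; have := mem_index_enum v.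
elim: index_enum => // x r IHr; rewrite big_cons inE => /orP[/eqP<-|/IHr le_v].
  by rewrite vV geq_minl.
by case: ifP => // _; apply: leq_trans (geq_minr _ _) le_v.
Qed.

Lemma card_class_sum (T : finType) (V : 'I_3 -> {set T}) (U : {set T}) :
  (forall i j : 'I_3, i != j -> [disjoint V i & V j]) ->
  U \subset vertices V -> \sum_i #|U :&: V i| = #|U|.
Proof.
move=> hdisj UV.
transitivity (\sum_i \sum_(x in U) (x \in V i)).
  apply: eq_bigr => i _; rewrite -sum1_card big_mkcond [RHS]big_mkcond /=.
  by apply: eq_bigr => x _; rewrite inE; case: (x \in U) => //; case: (x \in V i).
rewrite exchange_big -sum1_card; apply: eq_bigr => x xU.
have /bigcupP[i _ xi] := subsetP UV x xU.
rewrite (bigD1 i) //= xi big1 // => j ji.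
by case xj: (x \in V j) => //; rewrite (class_uniq hdisj xi xj) eqxx in ji.
Qed.

(** Counting edges by their vertex in the class that loses most to U leaves
enough of them for a greedy choice, by [residual_count], apart from the case of
two families on three classes of size n - r, which [disjoint_edges] settles. *)
Lemma light_rainbow (T I : finType) (V : 'I_3 -> {set T})
    (F : I -> {set {set T}}) (n r s : nat) (R : {set I}) (U : {set T}) :
  (forall i j : 'I_3, i != j -> [disjoint V i & V j]) ->
  (forall i, #|V i| = n) -> (forall i, tripartite_3graph V (F i)) ->
  1 <= s <= 3 -> #|I| = 3 * r + s -> 120 * #|I| <= n ->
  (forall i, (delta n r s < (min_degree V (F i))%:Z)%R) ->
  U \subset vertices V -> #|U| + #|R| = #|I| ->
  (forall i v, i \in R -> v \in vertices V -> v \notin U ->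
     degree (F i) v <= 4 * #|I| * n) ->
  exists f : I -> {set T}, (forall i, i \in R -> f i \in avoiding (F i) U) /\
    forall i j, i \in R -> j \in R -> i != j -> [disjoint f i & f j].
Proof.
move=> hdisj hV triF hs hI hn hdeg UV UR light.
have [R0|R0] := posnP #|R|.
  by exists (fun=> set0); split=> i; rewrite (cards0_eq R0) inE.
pose u i := #|U :&: V i|.
have VU i : #|V i :\: U| = n - u i by rewrite cardsD hV setIC.
have triA i : tripartite_3graph V (avoiding (F i) U).
  exact: tripartite_sub (avoiding_sub _ _) (triF i).
have deg a b c i v : a != b -> a != c -> b != c -> v \in V a -> v \notin U ->
    min_degree V (F i) + (n - u b) * (n - u c) <=
    degree (avoiding (F i) U) v + n * n.
  move=> ab ac bc va vU; rewrite -!VU.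
  apply: leq_trans (degree_avoiding hV (triF i) ab ac bc va vU).
  by rewrite leq_add2r min_degree_le //; apply/bigcupP; exists a.
have [a [b [c [ab ac bc ucba usum]]]] := ord3_sorted u.
rewrite (card_class_sum hdisj UV) in usum.
have [/and5P[/eqP q2 /eqP s2 /eqP ua /eqP ub /eqP uc]|balanced] :=
    boolP [&& #|R| == 2, s == 2, u a == r, u b == r & u c == r].
  have cov := ord3_cover ab ac bc.
  have ur i : u i = r by case/or3P: (cov i) => /eqP->.
  have deg2 k v i : v \in V i :\: U -> 1 < degree (avoiding (F k) U) v.
    rewrite inE => /andP[vU vi].
    have [b' [c' [ab' ac' bc']]] : exists b' c', [/\ i != b', i != c' & b' != c'].
      case/or3P: (cov i) => /eqP->; [exists b, c | exists a, c | exists a, b];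
        by split=> //; rewrite eq_sym.
    (* The bound is delta(n, r, 2) - n^2 + (n - r)^2 = 1. *)
    have := deg i b' c' k v ab' ac' bc' vi vU; rewrite !ur.
    have := hdeg k; rewrite s2 /delta !expr2.
    have -> : ((n%:Z - r%:Z) = (n - r)%N%:Z)%R by lia.
    move: (n - r) (min_degree _ _) (degree _ _); clear => N d1 d2.
    lia.
  have /cards2P[i [j [ij RE]]] := introT eqP q2.
  have [|||||e [e' [eG e'G dis]]] := @disjoint_edges T V
     (avoiding (F i) U) (avoiding (F j) U) (fun i => V i :\: U) (triA i) (triA j).
  + by move=> k; apply: subsetDl.
  + move=> k; rewrite VU ur; lia.
  + move=> w e; rewrite inE => /andP[_ dis]; apply/subsetP => x.
    by rewrite !inE => /andP[xe ->]; rewrite andbT (disjointFr dis xe).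
  + by move=> w v; apply: deg2.
  + by move=> w v; apply: deg2.
  exists (fun k => if k == i then e else e'); rewrite RE; split=> [k|k l].
    by case/set2P=> -> /=; rewrite ?eqxx // ifN_eqC.
  case/set2P=> -> /set2P[->|->] /=; rewrite ?eqxx // => _; rewrite (ifN_eqC _ _ ij) //.
  by rewrite disjoint_sym.
apply: (@greedy_rainbow T I R (fun i => avoiding (F i) U) (fun=> set0)).
- by move=> i e _; apply: edge_size.
- by move=> i j e _ _ _ _; rewrite -setI_eq0 setI0.
move=> i S iR Ssize _.
have [||e eA eS] := @exists_avoiding T (avoiding (F i) U) S (4 * #|I| * n).
- move=> x xS.
  have [d0|/card_gt0P[e]] := posnP (degree (avoiding (F i) U) x); first by rewrite d0.
  rewrite !inE => /andP[/andP[eF dis] xe].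
  apply: leq_trans (degree_sub _ (avoiding_sub _ _)) (light i x iR _ _).
    by have [/subsetP/(_ x xe)] := triF i e eF.
  by rewrite (disjointFr dis xe).
- have dle v : v \in V a :\: U ->
      min_degree V (F i) + (n - u b) * (n - u c) - n * n <=
      degree (avoiding (F i) U) v.
    rewrite inE => /andP[vU va]; have := deg a b c i v ab ac bc va vU; lia.
  have := card_edges_ge (triA i) (subsetDl (V a) U) dle; rewrite VU.
  set d := _ - n * n => edges.
  have [||||||count|[qE sE ua ub uc]] := @residual_count n r s #|R| (u a) (u b) (u c) d => //.
  + by rewrite -hI.
  + by rewrite usum UR hI.
  + have := hdeg i; rewrite /d expr2; lia.
  + apply: leq_trans edges; apply: leq_ltn_trans count; rewrite -hI.
    by rewrite leq_mul2r Ssize orbT.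
  by rewrite qE sE ua ub uc !eqxx in balanced.
by exists e.
Qed.

Theorem theorem1p4 (n m r s : nat) (T : finType) (V : 'I_3 -> {set T})
    (F : 'I_m -> {set {set T}})
    (hm : m = 3 * r + s) (hs : 1 <= s <= 3) (hn : 120 * m <= n)
    (hdisj : forall i j : 'I_3, i != j -> [disjoint V i & V j])
    (hV : forall i : 'I_3, #|V i| = n)
    (hF : forall i : 'I_m, tripartite_3graph V (F i))
    (hdeg : forall i : 'I_m, (delta n r s < (min_degree V (F i))%:Z)%R) :
  exists e : 'I_m -> {set T}, rainbow_matching F e.
Proof.
have [x0 _] : exists x, x \in V ord0 by apply/card_gt0P; rewrite hV; lia.
have [K [phi [inj heavy light]]] := maximal_partial_matching x0
  (fun (i : 'I_m) v => (v \in vertices V) && (4 * m * n < degree (F i) v)).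
have Im : #|'I_m| = m := card_ord m.
set U := phi @: K in light.
have cU : #|U| = #|K| by rewrite card_in_imset.
have [||||||f [fF fd]] := @light_rainbow T 'I_m V F n r s (~: K) U hdisj hV hF hs;
  rewrite ?Im //.
- by apply/subsetP => _ /imsetP[k /heavy/andP[kV _] ->].
- by rewrite cU cardsC Im.
- move=> i v; rewrite inE => iK vV vU.
  by have := light i v iK vU; rewrite vV /= -leqNgt.
pose M0 := \bigcup_(i in ~: K) f i.
have [||k kK|g [gF gd]] := @extend_heavy T 'I_m V F n K phi M0 hV hF inj.
- rewrite -(cardsC K) addKn.
  apply: card_bigcup_le => i /fF; rewrite inE => /andP[eF _].
  exact: edge_size (hF i) eF.
- rewrite disjoint_sym; apply: bigcup_disjoint => i /fF; rewrite inE => /andP[_].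
  by rewrite disjoint_sym.
- by rewrite Im; have /andP[] := heavy k kK.
have fg i k : i \notin K -> k \in K -> [disjoint g k & f i].
  move=> iK kK; have := gF k kK; rewrite inE => /andP[_].
  by apply: disjointWr; apply: (bigcup_sup i); rewrite ?inE.
exists (fun i => if i \in K then g i else f i); split=> [i|i j ij].
  case: ifPn => iK; first exact: (subsetP (avoiding_sub _ _) _ (gF i iK)).
  by apply: (subsetP (avoiding_sub _ _) _ (fF i _)); rewrite inE.
case: ifPn => iK; case: ifPn => jK.
- exact: gd.
- exact: fg.
- by rewrite disjoint_sym; apply: fg.
- by apply: fd; rewrite ?inE.
Qed.
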